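(* Let $m\ge2$ and let $x:\Sigma^m\to\mathbb{R}^{m+1}$ be a smooth closed, two-sided immersed hypersurface with unit normal $\nu$ and constant weighted mean curvature $H_\phi=H+\frac12\langle x,\nu\rangle$. Then, at every point of $\Sigma$, $$V\,L_\phi F=V\bigl(PV-H_\phi^2\bigr)\ge H_\phi A(x^\top,x^\top).$$ Moreover, the inequality is strict at every point where $x^\top\neq0$.
   Context: For a two-sided immersed hypersurface $x:\Sigma^m\to\mathbb{R}^{m+1}$ with globally defined unit normal $\nu$, let $A(X,Y)=\langle\overline\nabla_X\nu,Y\rangle$ be the second fundamental form ($\overline\nabla$ is the Euclidean connection), $H=\operatorname{tr}_\Sigma A$ the mean curvature, and $x^\top$ the component of the position vector $x$ tangent to $\Sigma$. The weighted mean curvature in the anti-Gaussian space $(\mathbb{R}^{m+1},e^{|x|^2/4}dx)$ is $H_\phi=H+\frac12\langle x,\nu\rangle$ (here $\phi=-|x|^2/4$). With $\Delta,\nabla$ the Laplacian and gradient of the induced metric on $\Sigma$, set $$\Delta_\phi f=\Delta f+\tfrac12\langle x^\top,\nabla f\rangle,\qquad L_\phi f=\Delta_\phi f+\bigl(|A|^2-\tfrac12\bigr)f,$$ $$V=m+\frac{|x|^2}{2},\qquad P=|A|^2+\frac12,\qquad F=V-H_\phi\langle x,\nu\rangle .$$ *)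

(* Defs.v *)
From mathcomp Require Import all_boot all_order all_algebra.
From mathcomp Require Import all_classical all_reals all_analysis.

Set Implicit Arguments.
Unset Strict Implicit.
Unset Printing Implicit Defensive.

Import Order.TTheory GRing.Theory Num.Theory.
Import numFieldNormedType.Exports.

Local Open Scope classical_set_scope.
Local Open Scope ring_scope.

Definition dot (R : realType) (n : nat) (u v : 'rV[R]_n) : R :=
  \sum_(k < n) u 0 k * v 0 k.

Section Smooth.
Context {R : realType} {m : nat} {W : normedModType R}.

Definition iter_partial (s : seq 'I_m) (f : 'rV[R]_m -> W) : 'rV[R]_m -> W :=
  foldr (fun i g => 'D_(delta_mx 0 i) g) f s.

(* C^infinity on the open set U: every iterated partial derivative exists and
   is (Frechet) differentiable, hence continuous, at every point of U. *)
Definition smooth_on (U : set 'rV[R]_m) (f : 'rV[R]_m -> W) : Prop :=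
  forall (s : seq 'I_m) u, U u -> differentiable (iter_partial s f) u.

End Smooth.

(* [chart_map] and [chart_inv] are total functions; only their restrictions to
   [chart_dom] and [chart_cod], mutually inverse homeomorphisms, are meaningful. *)
Record chart (R : realType) (m : nat) (T : topologicalType) := Chart {
  chart_dom : set T;
  chart_cod : set 'rV[R]_m;
  chart_map : T -> 'rV[R]_m;
  chart_inv : 'rV[R]_m -> T;
  chart_dom_open : open chart_dom;
  chart_cod_open : open chart_cod;
  chart_map_cod : forall p, chart_dom p -> chart_cod (chart_map p);
  chart_inv_dom : forall u, chart_cod u -> chart_dom (chart_inv u);
  chart_mapK : forall p, chart_dom p -> chart_inv (chart_map p) = p;
  chart_invK : forall u, chart_cod u -> chart_map (chart_inv u) = u;
  chart_map_continuous : forall p, chart_dom p -> {for p, continuous chart_map};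
  chart_inv_continuous : forall u, chart_cod u -> {for u, continuous chart_inv}
}.

Record smoothManifold (R : realType) (m : nat) := SmoothManifold {
  carrier :> topologicalType;
  manifold_hausdorff : hausdorff_space carrier;
  manifold_second_countable : @second_countable carrier;
  atlas : set (chart R m carrier);
  atlas_cover : forall p : carrier, exists c, atlas c /\ chart_dom c p;
  atlas_compatible : forall c c', atlas c -> atlas c' ->
    smooth_on (chart_cod c `&` chart_inv c @^-1` chart_dom c')
      (chart_map c' \o chart_inv c)
}.

Section Geometry.
Context {R : realType} {m : nat} {M : smoothManifold R m}.

Definition chart_at (p : M) : chart R m M := projT1 (cid (atlas_cover p)).

Definition smooth_map (W : normedModType R) (f : M -> W) : Prop :=
  forall c, atlas c -> smooth_on (chart_cod c) (f \o chart_inv c).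

Definition immersion (n : nat) (x : M -> 'rV[R]_n) : Prop :=
  smooth_map x /\
  forall c p, atlas c -> chart_dom c p ->
    injective ('d (x \o chart_inv c) (chart_map c p)).

Definition unit_normal (x nu : M -> 'rV[R]_m.+1) : Prop :=
  [/\ smooth_map nu,
      forall p, dot (nu p) (nu p) = 1
    & forall c p v, atlas c -> chart_dom c p ->
        dot (nu p) ('d (x \o chart_inv c) (chart_map c p) v) = 0].

(* df/du^i in the chart c; meaningful on [chart_dom c]. *)
Definition chart_partial (W : normedModType R) (c : chart R m M) (i : 'I_m)
    (f : M -> W) : M -> W :=
  fun p => 'D_(delta_mx 0 i) (f \o chart_inv c) (chart_map c p).

Section Coordinates.
Variables (x : M -> 'rV[R]_m.+1) (c : chart R m M).

Definition metric (i j : 'I_m) (p : M) : R :=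
  dot (chart_partial c i x p) (chart_partial c j x p).

Definition inv_metric (i j : 'I_m) (p : M) : R :=
  invmx (\matrix_(k, l) metric k l p) i j.

Definition christoffel (k i j : 'I_m) (p : M) : R :=
  2^-1 * \sum_l inv_metric k l p *
    (chart_partial c i (metric j l) p + chart_partial c j (metric i l) p
     - chart_partial c l (metric i j) p).

Definition hessian (f : M -> R) (i j : 'I_m) (p : M) : R :=
  chart_partial c i (chart_partial c j f) p
  - \sum_k christoffel k i j p * chart_partial c k f p.

End Coordinates.

(* From here on, expressions at p are written in the chart [chart_at p].
   Tangent vectors are represented by their images in R^(m+1) under dx. *)

Definition laplacian (x : M -> 'rV[R]_m.+1) (f : M -> R) (p : M) : R :=
  let c := chart_at p in
  \sum_i \sum_j inv_metric x c i j p * hessian x c f i j p.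

Definition gradient (x : M -> 'rV[R]_m.+1) (f : M -> R) (p : M) :
    'rV[R]_m.+1 :=
  let c := chart_at p in
  \sum_i \sum_j
    (inv_metric x c i j p * chart_partial c i f p) *: chart_partial c j x p.

(* The derivative at p of the R^(m+1)-valued field Y along the tangent vector
   v, whose i-th component in the coordinate frame is
   \sum_j g^{ij} <v, dx/du^j>. *)
Definition tangent_derivative (x Y : M -> 'rV[R]_m.+1) (p : M)
    (v : 'rV[R]_m.+1) : 'rV[R]_m.+1 :=
  let c := chart_at p in
  \sum_i (\sum_j inv_metric x c i j p * dot v (chart_partial c j x p))
    *: chart_partial c i Y p.

Section Hypersurface.
Variables x nu : M -> 'rV[R]_m.+1.

Definition second_form (p : M) (v w : 'rV[R]_m.+1) : R :=
  dot (tangent_derivative x nu p v) w.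

Definition mean_curvature (p : M) : R :=
  let c := chart_at p in
  \sum_i \sum_j inv_metric x c i j p *
    second_form p (chart_partial c i x p) (chart_partial c j x p).

Definition second_form_sqnorm (p : M) : R :=
  let c := chart_at p in
  let A i j := second_form p (chart_partial c i x p) (chart_partial c j x p) in
  \sum_i \sum_j \sum_k \sum_l
    inv_metric x c i k p * inv_metric x c j l p * A i j * A k l.

Definition tangent_part (p : M) : 'rV[R]_m.+1 :=
  x p - dot (x p) (nu p) *: nu p.

Definition weighted_mean_curvature (p : M) : R :=
  mean_curvature p + 2^-1 * dot (x p) (nu p).

Definition weighted_laplacian (f : M -> R) (p : M) : R :=
  laplacian x f p + 2^-1 * dot (tangent_part p) (gradient x f p).

Definition stability_operator (f : M -> R) (p : M) : R :=
  weighted_laplacian f p + (second_form_sqnorm p - 2^-1) * f p.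

Definition potential_V (p : M) : R := m%:R + dot (x p) (x p) / 2.

Definition potential_P (p : M) : R := second_form_sqnorm p + 2^-1.

Definition test_F (p : M) : R :=
  potential_V p - weighted_mean_curvature p * dot (x p) (nu p).

End Hypersurface.
End Geometry.

(* Main.v *)
Require Import Defs.
From mathcomp Require Import all_boot all_order all_fingroup all_algebra.
From mathcomp Require Import all_classical all_reals all_analysis.
From mathcomp Require Import ring lra.

(** Write h for the constant weighted mean curvature, s = <x, nu>, xT for the
    tangential part of x, and S for the Weingarten map.

    Equality.  The Gauss formula gives Delta x = - H nu, and the Codazzi equation gives
    Delta nu = grad H - |A|^2 nu, where grad H = - (1/2) S xT because H = h - s/2.
    Hence L_phi V = F + (|A|^2 - 1/2) V and L_phi s = h - s, and L_phi F = P V - h^2.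

    Inequality.  If xT = 0, Cauchy-Schwarz applied to h = H * 1 + (1/2) * s gives
    h^2 <= P V.  Otherwise let a = A(xT, xT) / |xT|^2, K = m - 1 + s^2/2 and
    u = |xT|^2 / 2, so that V = K + 1 + u.  The trace of S off the direction xT is
    H - a, hence P >= a^2 + (h - a)^2 / K, and the claim reduces to positivity of a
    quadratic form in (a, h) whose determinant is, up to the factor u / K > 0,
    V^2 (V - 2) - K u; this is positive since V - 2 >= u and V^2 > K. *)

Set Implicit Arguments.
Unset Strict Implicit.
Unset Printing Implicit Defensive.

Import Order.TTheory GRing.Theory Num.Theory.
Import numFieldNormedType.Exports.
Local Open Scope classical_set_scope.
Local Open Scope ring_scope.

(** * Linear algebra of the shape operator *)

Lemma dotE (R : realType) n (u v : 'rV[R]_n) : dot u v = (u *m v^T) 0 0.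
Proof. by rewrite mxE; apply: eq_bigr => k _; rewrite mxE. Qed.

Lemma dotC (R : realType) n (u v : 'rV[R]_n) : dot u v = dot v u.
Proof. by apply: eq_bigr => k _; rewrite mulrC. Qed.

Lemma dotBl (R : realType) n (u v w : 'rV[R]_n) : dot (u - v) w = dot u w - dot v w.
Proof. by rewrite /dot -sumrB; apply: eq_bigr => k _; rewrite !mxE mulrBl. Qed.

Lemma dotDl (R : realType) n (u v w : 'rV[R]_n) : dot (u + v) w = dot u w + dot v w.
Proof. by rewrite /dot -big_split; apply: eq_bigr => k _; rewrite !mxE mulrDl. Qed.

Lemma dotZl (R : realType) n a (u v : 'rV[R]_n) : dot (a *: u) v = a * dot u v.
Proof. by rewrite /dot mulr_sumr; apply: eq_bigr => k _; rewrite !mxE mulrA. Qed.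

Lemma dot_suml (R : realType) n (I : finType) (u : I -> 'rV[R]_n) v :
  dot (\sum_i u i) v = \sum_i dot (u i) v.
Proof.
rewrite /dot exchange_big; apply: eq_bigr => k _.
by rewrite summxE mulr_suml.
Qed.

Lemma dot_mulmx (R : realType) p n (u : 'rV[R]_p) (A : 'M[R]_(p, n)) v :
  dot (u *m A) v = dot u (v *m A^T).
Proof. by rewrite !dotE trmx_mul trmxK mulmxA. Qed.

Lemma mulmx_trE (R : realType) p q r (A : 'M[R]_(p, r)) (B : 'M[R]_(q, r)) i j :
  (A *m B^T) i j = dot (row i A) (row j B).
Proof. by rewrite mxE; apply: eq_bigr => k _; rewrite !mxE. Qed.

Lemma dot_ge0 (R : realType) n (v : 'rV[R]_n) : 0 <= dot v v.
Proof. by apply: sumr_ge0 => k _; rewrite -expr2 sqr_ge0. Qed.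

Lemma dot_gt0 (R : realType) n (v : 'rV[R]_n) : v <> 0 -> 0 < dot v v.
Proof.
move=> v0; rewrite lt0r dot_ge0 andbT; apply/eqP => /eqP.
rewrite psumr_eq0 => [/allP vk|k _]; last by rewrite -expr2 sqr_ge0.
apply: v0; apply/rowP => k; have /implyP/(_ isT) := vk k (mem_index_enum _).
by rewrite mulf_eq0 orbb => /eqP ->; rewrite mxE.
Qed.

Lemma dot_orthogonal_sum (R : realType) n (w z : 'rV[R]_n) s :
  dot z z = 1 -> dot w z = 0 ->
  dot (w + s *: z) (w + s *: z) = s ^+ 2 + dot w w.
Proof.
move=> zz wz; rewrite dotDl dotZl (dotC w) (dotC z) !dotDl !dotZl (dotC z) zz wz.
by ring.
Qed.

(** * Lower bounds for |A|^2 and the scalar inequalities they imply *)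

Section Inequality.
Context {R : realFieldType}.

Lemma mxtrace_mulmx_tr_ge0 p q (D : 'M[R]_(p, q)) : 0 <= \tr (D *m D^T).
Proof.
apply: sumr_ge0 => i _; rewrite mxE; apply: sumr_ge0 => j _.
by rewrite mxE -expr2 sqr_ge0.
Qed.

Lemma mxtrace_outer n (A : 'M[R]_n) (v w : 'rV[R]_n) :
  \tr (A *m (v^T *m w)) = (w *m A *m v^T) 0 0.
Proof. by rewrite mulmxA mxtrace_mulC mulmxA /mxtrace big_ord1. Qed.

(** The expression is the squared Frobenius norm of [S - al v^T v - c Q], where [Q = 1 - nu^T nu] is
    the tangential projection, of trace [n]. The choice of [al] and [c] turns this one expansion
    into each lower bound for |A|^2 below. *)
Lemma frobenius_expansion_ge0 n (S : 'M[R]_n.+1) (v nu : 'rV[R]_n.+1) (al c : R) :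
  nu *m nu^T = 1%:M -> v *m nu^T = 0 -> S *m nu^T = 0 ->
  0 <= \tr (S *m S^T) - 2 * al * (v *m S *m v^T) 0 0 - 2 * c * \tr S
       + al ^+ 2 * ((v *m v^T) 0 0) ^+ 2 + 2 * al * c * (v *m v^T) 0 0
       + c ^+ 2 * n%:R.
Proof.
move=> nunu vnu Snu.
set D := S - al *: (v^T *m v) - c *: (1%:M - nu^T *m nu).
have := mxtrace_mulmx_tr_ge0 D.
have nuv : nu *m v^T = 0 by apply: trmx_inj; rewrite trmx_mul trmxK trmx0.
have nuS : nu *m S^T = 0 by apply: trmx_inj; rewrite trmx_mul trmxK trmx0.
have trS (A : 'M[R]_n.+1) : \tr A^T = \tr A by rewrite mxtrace_tr.
have e1 : \tr (S *m (v^T *m v)) = (v *m S *m v^T) 0 0 by exact: mxtrace_outer.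
have e2 : \tr ((v^T *m v) *m S^T) = (v *m S *m v^T) 0 0.
  by rewrite -trS trmx_mul trmxK trmx_mul trmxK e1.
have DT : D^T = S^T - al *: (v^T *m v) - c *: (1%:M - nu^T *m nu).
  by rewrite /D !raddfB /= !linearZ /= ?raddfB /= !trmx_mul !trmxK trmx1.
have tvv : \tr (v^T *m v) = (v *m v^T) 0 0.
  by rewrite mxtrace_mulC /mxtrace big_ord1.
have tnn : \tr (nu^T *m nu) = 1.
  by rewrite mxtrace_mulC nunu /mxtrace big_ord1 mxE.
have vv4 : \tr ((v^T *m v) *m (v^T *m v)) = ((v *m v^T) 0 0) ^+ 2.
  rewrite mxtrace_outer mulmxA -mulmxA [LHS]mxE big_ord1 expr2 //.
have vQ : (v^T *m v) *m (1%:M - nu^T *m nu) = v^T *m v.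
  by rewrite mulmxBr mulmx1 -mulmxA (mulmxA v) vnu mul0mx mulmx0 subr0.
have Qv : (1%:M - nu^T *m nu) *m (v^T *m v) = v^T *m v.
  by rewrite mulmxBl mul1mx -mulmxA (mulmxA nu) nuv mul0mx mulmx0 subr0.
have SQ : S *m (1%:M - nu^T *m nu) = S.
  by rewrite mulmxBr mulmx1 mulmxA Snu mul0mx subr0.
have QS : (1%:M - nu^T *m nu) *m S^T = S^T.
  by rewrite mulmxBl mul1mx -mulmxA nuS mulmx0 subr0.
have QQ : (1%:M - nu^T *m nu) *m (1%:M - nu^T *m nu) = 1%:M - nu^T *m nu.
  by rewrite mulmxBr mulmx1 mulmxBl mul1mx -!mulmxA (mulmxA nu) nunu mul1mx subrr subr0.
rewrite DT /D !(mulmxBl, mulmxBr S) !(mulmxBr (al *: _)) !(mulmxBr (c *: _)).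
rewrite -!(scalemxAl, scalemxAr) vQ Qv SQ QS QQ.
rewrite !raddfB /= !mxtraceZ e1 e2 vv4 tvv tnn trS mxtrace1 -natr1.
set X := (X in 0 <= X -> _); set Y := (Y in _ -> 0 <= Y).
by rewrite (_ : Y = X) // /X /Y; ring.
Qed.

(* The left-hand side is the squared norm of the operator equal to [a] on [v] and to
   [(\tr S - a) / (n - 1)] times the identity on the tangent vectors orthogonal to [v]. *)
Lemma shape_sqnorm_lower_bound n (S : 'M[R]_n.+1) (v nu : 'rV[R]_n.+1) (a : R) :
  (2 <= n)%N -> nu *m nu^T = 1%:M -> v *m nu^T = 0 -> S *m nu^T = 0 ->
  (v *m v^T) 0 0 != 0 -> (v *m S *m v^T) 0 0 = a * (v *m v^T) 0 0 ->
  a ^+ 2 + (\tr S - a) ^+ 2 / (n%:R - 1) <= \tr (S *m S^T).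
Proof.
move=> n2 nunu vnu Snu t0 ha.
have k0 : (n%:R - 1 : R) != 0.
  by rewrite subr_eq0 pnatr_eq1; case: n n2 {S v nu nunu vnu Snu t0 ha} => [|[]].
set c := (\tr S - a) / (n%:R - 1).
(* With this coefficient the comparison operator [al v^T v + c Q] acts on [v] as the scalar
   [(a - c) + c = a]. *)
have := frobenius_expansion_ge0 ((a - c) / (v *m v^T) 0 0) c nunu vnu Snu.
rewrite ha => h; rewrite -subr_ge0.
apply: le_trans h _; rewrite le_eqVlt; apply/orP; left; apply/eqP.
by rewrite /c; field; rewrite k0 t0.
Qed.

Lemma shape_sqnorm_trace n (S : 'M[R]_n.+1) (nu : 'rV[R]_n.+1) :
  (0 < n)%N -> nu *m nu^T = 1%:M -> S *m nu^T = 0 ->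
  (\tr S) ^+ 2 / n%:R <= \tr (S *m S^T).
Proof.
move=> n0 nunu Snu.
have k0 : (n%:R : R) != 0 by rewrite pnatr_eq0 -lt0n.
(* The comparison operator is the multiple of the tangential projection that has the trace of [S];
   the vector [v] is taken to be 0. *)
have := frobenius_expansion_ge0 0 (\tr S / n%:R) nunu (mul0mx _ nu^T) Snu.
move=> h; rewrite -subr_ge0.
apply: le_trans h _; rewrite le_eqVlt; apply/orP; left; apply/eqP.
by rewrite !mul0mx mxE; field.
Qed.

(** Cauchy-Schwarz for the pairs [(H / sqrt n, 1 / sqrt 2)] and [(sqrt n, s / sqrt 2)]. Besides the
    points with xT = 0, it serves with [n - 1] and [H - a] in place of [n] and [H]. *)
Lemma weighted_inequality_umbilic (n A2 H s : R) :
  0 < n -> H ^+ 2 / n <= A2 ->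
  (H + 2^-1 * s) ^+ 2 <= (A2 + 2^-1) * (n + s ^+ 2 / 2).
Proof.
move=> n0 hA; have s2 := sqr_ge0 s.
have V0 : 0 < n + s ^+ 2 / 2 by lra.
have : (H ^+ 2 / n + 2^-1) * (n + s ^+ 2 / 2) <= (A2 + 2^-1) * (n + s ^+ 2 / 2).
  by rewrite ler_pM2r // lerD2r.
apply: le_trans; rewrite -subr_ge0.
have -> : (H ^+ 2 / n + 2^-1) * (n + s ^+ 2 / 2) - (H + 2^-1 * s) ^+ 2 =
  n / 2 * (1 - H * s / n) ^+ 2 by field; rewrite gt_eqF.
by rewrite mulr_ge0 ?sqr_ge0 // divr_ge0 ?ltW.
Qed.

Lemma weighted_inequality_strict (n A2 H a s t V h : R) :
  V = n + (s ^+ 2 + t) / 2 -> h = H + 2^-1 * s -> 2 <= n -> 0 < t ->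
  a ^+ 2 + (H - a) ^+ 2 / (n - 1) <= A2 ->
  h * (a * t) < V * ((A2 + 2^-1) * V - h ^+ 2).
Proof.
move=> hV hh n2 t0 hA; have s2 := sqr_ge0 s.
pose K := n - 1 + s ^+ 2 / 2; pose u := t / 2; set P := A2 + 2^-1.
have K1 : 1 <= K by rewrite /K; lra.
have u0 : 0 < u by rewrite /u; lra.
have VE : V = K + 1 + u by rewrite hV /K /u; field.
have V0 : 0 < V by lra.
(* The summand 1/2 of [P] is spent here: Cauchy-Schwarz off the direction xT replaces [H - a] by
   [h - a] and [n - 1] by [K]. *)
have hP : a ^+ 2 + (h - a) ^+ 2 / K <= P.
  have := @weighted_inequality_umbilic (n - 1) ((H - a) ^+ 2 / (n - 1)) (H - a) s.
  move=> /(_ _ (lexx _)) h1.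
  have /h1 : 0 < n - 1 by lra.
  rewrite -/K -ler_pdivrMr; last by lra.
  have -> : H - a + 2^-1 * s = h - a by rewrite hh; ring.
  by rewrite /P; lra.
have tE : t = 2 * u by rewrite /u; field.
(* Completing the square below is strict only through its term in [h ^+ 2], so [h = 0] is treated
   apart; there positivity of [P] suffices. *)
have [h0|h0] := eqVneq h 0.
  have P0 : 0 < P.
    by have := mulr_ge0 (sqr_ge0 (H - a)) (_ : 0 <= (n - 1)^-1);
      have := sqr_ge0 a; rewrite /P invr_ge0; lra.
  by rewrite h0 mul0r expr0n subr0 !mulr_gt0.
have h2 : 0 < h ^+ 2 by rewrite exprn_even_gt0.
(* [al], [be] and [ga] are the coefficients of [V^2 (a^2 + (h - a)^2 / K) - V h^2 - h a t] as a
   quadratic form in [(a, h)], with [t = 2 u]. *)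
pose al := V ^+ 2 * (1 + K^-1); pose be := - (V ^+ 2 / K + u).
pose ga := V ^+ 2 / K - V.
have K0 : 0 < K by lra.
have al0 : 0 < al by rewrite /al mulr_gt0 ?exprn_gt0 // addr_gt0 ?invr_gt0.
have form0 : 0 < al * a ^+ 2 + 2 * be * a * h + ga * h ^+ 2.
  rewrite -(pmulr_rgt0 _ al0).
  have -> : al * (al * a ^+ 2 + 2 * be * a * h + ga * h ^+ 2) =
     (al * a + be * h) ^+ 2 + (al * ga - be ^+ 2) * h ^+ 2 by ring.
  rewrite ltr_wpDl ?sqr_ge0 // mulr_gt0 //.
  have -> : al * ga - be ^+ 2 = u / K * (V ^+ 2 * (V - 2) - K * u).
    by rewrite /al /ga /be VE; field; rewrite gt_eqF.
  rewrite mulr_gt0 ?divr_gt0 // subr_gt0.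
  have : K * u < V ^+ 2 * u by rewrite ltr_pM2r // VE expr2; nra.
  move=> /lt_le_trans; apply; rewrite ler_pM2l ?exprn_gt0 //; lra.
rewrite -subr_gt0; apply: lt_le_trans form0 _.
have : V ^+ 2 * (a ^+ 2 + (h - a) ^+ 2 / K) <= V ^+ 2 * P.
  by rewrite ler_pM2l ?exprn_gt0.
rewrite -subr_ge0 => h'; rewrite -subr_ge0.
apply: le_trans h' _; rewrite le_eqVlt; apply/orP; left; apply/eqP.
by rewrite /al /be /ga tE; field; rewrite gt_eqF.
Qed.

End Inequality.

(** * Matrix calculus and mixed partial derivatives *)

Section MatrixCalculus.
Context {R : realType} {V : normedModType R}.
Implicit Types (t v : V).

Lemma is_derive_mxP p q (M : V -> 'M[R]_(p, q)) (dM : 'M[R]_(p, q)) t v :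
  is_derive t v M dM <->
  (forall i j, is_derive t v (fun x => M x i j) (dM i j)).
Proof.
split=> [[dm <-] i j|dm].
  apply: DeriveDef; first by move: i j; apply/derivable_mxP.
  by rewrite derive_mx // mxE.
have Md : derivable M t v by apply/derivable_mxP => i j; have [] := dm i j.
apply: DeriveDef => //; rewrite derive_mx //; apply/matrixP => i j.
by rewrite mxE; have [] := dm i j.
Qed.

Lemma is_derive_bigsum (I : Type) (r : seq I) (P : pred I) (f : I -> V -> R)
    (df : I -> R) t v :
  (forall i, P i -> is_derive t v (f i) (df i)) ->
  is_derive t v (fun x => \sum_(i <- r | P i) f i x) (\sum_(i <- r | P i) df i).
Proof.
move=> fd; elim: r => [|i r IHr].
  rewrite big_nil (_ : (fun _ => _) = cst 0); first exact: is_derive_cst.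
  by apply/funext => x; rewrite big_nil.
rewrite big_cons; case: ifPn => Pi.
  rewrite (_ : (fun _ => _) = f i + fun x => \sum_(i <- r | P i) f i x).
    exact: is_deriveD (fd i Pi) IHr.
  by apply/funext => x; rewrite big_cons Pi.
rewrite (_ : (fun _ => _) = fun x => \sum_(i <- r | P i) f i x) //.
by apply/funext => x; rewrite big_cons (negbTE Pi).
Qed.

Lemma derivable_bigprod (I : Type) (r : seq I) (P : pred I) (f : I -> V -> R) t v :
  (forall i, P i -> derivable (f i) t v) ->
  derivable (fun x => \prod_(i <- r | P i) f i x) t v.
Proof.
move=> fd; elim: r => [|i r IHr].
  rewrite (_ : (fun _ => _) = cst 1); first exact: derivable_cst.
  by apply/funext => x; rewrite big_nil.
have [Pi|Pi] := boolP (P i).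
  rewrite (_ : (fun _ => _) = f i * fun x => \prod_(i <- r | P i) f i x).
    exact: derivableM (fd i Pi) IHr.
  by apply/funext => x; rewrite big_cons Pi.
rewrite (_ : (fun _ => _) = fun x => \prod_(i <- r | P i) f i x) //.
by apply/funext => x; rewrite big_cons (negbTE Pi).
Qed.

Lemma is_derive_mulmx p q r (A : V -> 'M[R]_(p, q)) (B : V -> 'M[R]_(q, r))
    dA dB t v :
  is_derive t v A dA -> is_derive t v B dB ->
  is_derive t v (fun x => A x *m B x) (dA *m B t + A t *m dB).
Proof.
move=> /is_derive_mxP Ad /is_derive_mxP Bd; apply/is_derive_mxP => i j.
rewrite (_ : (fun _ => _) = fun x => \sum_k A x i k * B x k j); last first.
  by apply/funext => x; rewrite mxE.
rewrite !mxE -big_split /=; apply: is_derive_bigsum => k _.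
apply: is_derive_eq (is_deriveM (Ad i k) (Bd k j)) _.
by rewrite /GRing.scale /= addrC [B t k j * _]mulrC.
Qed.

Lemma is_derive_trmx p q (A : V -> 'M[R]_(p, q)) dA t v :
  is_derive t v A dA -> is_derive t v (fun x => (A x)^T) dA^T.
Proof.
move=> /is_derive_mxP Ad; apply/is_derive_mxP => i j.
rewrite mxE (_ : (fun _ => _) = fun x => A x j i) //.
by apply/funext => x; rewrite mxE.
Qed.

Lemma is_derive_mxtrace p (A : V -> 'M[R]_p) dA t v :
  is_derive t v A dA -> is_derive t v (fun x => \tr (A x)) (\tr dA).
Proof. by move=> /is_derive_mxP Ad; exact: is_derive_bigsum. Qed.

Lemma derivable_determinant p (A : V -> 'M[R]_p) t v :
  derivable A t v -> derivable (fun x => \det (A x)) t v.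
Proof.
move=> /derivable_mxP Ad.
suff [] : is_derive t v (fun x => \det (A x))
  (\sum_(s : 'S_p) 'D_v (fun x => (-1) ^+ s * \prod_i A x i (s i)) t) by [].
apply: is_derive_bigsum => s _; apply: derivableP.
rewrite (_ : (fun _ => _) = (-1) ^+ s *: fun x => \prod_i A x i (s i)) //.
by apply: derivableZ; apply: derivable_bigprod => i _.
Qed.

(** Cramer's rule shows that the inverse is derivable; its derivative is then read off from
    [A x *m invmx (A x) = 1]. Invertibility is assumed near [t] because [invmx] returns a singular
    matrix unchanged. *)
Lemma is_derive_invmx p (A : V -> 'M[R]_p) dA t v :
  (\forall x \near t, A x \in unitmx) -> is_derive t v A dA ->
  is_derive t v (fun x => invmx (A x)) (- (invmx (A t) *m dA *m invmx (A t))).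
Proof.
move=> Au Ad.
have At : A t \in unitmx by exact: nbhs_singleton Au.
have Id : derivable (fun x => invmx (A x)) t v.
  apply: (@near_eq_derivable _ _ _ (fun x => (\det (A x))^-1 *: \adj (A x))).
    by near=> x; rewrite /invmx (_ : A x \in unitmx) //; near: x.
  apply/derivable_mxP => i j.
  rewrite (_ : (fun _ => _) =
    (fun x => (\det (A x))^-1) * fun x => (-1) ^+ (j + i) * \det (row' j (col' i (A x)))).
    apply: derivableM.
      apply: derivableV; first by move: At; rewrite unitmxE unitfE.
      exact: derivable_determinant.
    rewrite (_ : (fun _ => _) = (-1) ^+ (j + i) *:
        fun x => \det (row' j (col' i (A x)))) //.
    apply/derivableZ/derivable_determinant/derivable_mxP => k l.
    rewrite (_ : (fun _ => _) = fun x => A x (lift j k) (lift i l)).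
      by move: (@ex_derive _ _ _ _ _ _ _ Ad) => /derivable_mxP; apply.
    by apply/funext => x; rewrite !mxE.
  by apply/funext => x; rewrite !mxE.
have hI := derivableP Id; set dI := 'D_v _ t in hI.
apply: (is_derive_eq hI).
have prod := is_derive_mulmx Ad hI.
have one : is_derive t v (fun x => A x *m invmx (A x)) 0.
  apply: (@near_eq_is_derive _ _ _ (cst 1%:M)) (is_derive_cst _ _ _).
  by near=> x; rewrite mulmxV //; near: x.
have := @derive_val _ _ _ _ _ _ _ prod; rewrite (@derive_val _ _ _ _ _ _ _ one).
move=> /esym/(canRL (addKr _)); rewrite addr0 => /(congr1 (mulmx (invmx (A t)))).
by rewrite mulKmx // mulmxN mulmxA.
Unshelve. all: by end_near. Qed.

Lemma is_derive_dot n (f g : V -> 'rV[R]_n) df dg t v :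
  is_derive t v f df -> is_derive t v g dg ->
  is_derive t v (fun x => dot (f x) (g x)) (dot df (g t) + dot (f t) dg).
Proof.
move=> /is_derive_mxP fd /is_derive_mxP gd.
rewrite /dot -big_split /=; apply: is_derive_bigsum => k _.
apply: is_derive_eq (is_deriveM (fd 0 k) (gd 0 k)) _.
by rewrite /GRing.scale /= addrC [g t 0 k * _]mulrC.
Qed.

End MatrixCalculus.

(** * Symmetry of mixed directional derivatives *)

Section MixedDerivatives.
Context {R : realType} {V : normedModType R}.

Lemma is_derive_line (f : V -> R) b v r df :
  is_derive (b + r *: v) v f df ->
  is_derive r 1 (fun r => f (b + r *: v)) df.
Proof.
rewrite /derive => -[fd <-].
have e : (fun h => h^-1 *: (((fun r => f (b + r *: v)) \o shift r) (h *: 1) - f (b + r *: v)))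
  = (fun h => h^-1 *: ((f \o shift (b + r *: v)) (h *: v) - f (b + r *: v))).
  apply/funext => h /=; congr (_ *: (f _ - _)).
  by rewrite [h%:A]mulr1 scalerDl addrCA.
by apply: DeriveDef; rewrite /derivable /derive e.
Qed.

Lemma is_derive_translate (f : V -> R) a b v df :
  is_derive (a + b) v f df -> is_derive a v (fun x => f (x + b)) df.
Proof.
rewrite /derive => -[fd <-].
have e : (fun h => h^-1 *: (((fun x => f (x + b)) \o shift a) (h *: v) - f (a + b)))
  = (fun h => h^-1 *: ((f \o shift (a + b)) (h *: v) - f (a + b))).
  by apply/funext => h /=; rewrite addrA.
by apply: DeriveDef; rewrite /derivable /derive e.
Qed.

Lemma MVT_line (f fv : V -> R) b v (s : R) : 0 < s ->
  (forall r, 0 <= r <= s -> is_derive (b + r *: v) v f (fv (b + r *: v))) ->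
  exists2 r, 0 <= r <= s & f (b + s *: v) - f b = s * fv (b + r *: v).
Proof.
move=> s0 fd.
have ld r : 0 <= r <= s -> is_derive r 1 (fun r => f (b + r *: v)) (fv (b + r *: v)).
  by move=> /fd; exact: is_derive_line.
have [||r] := @MVT _ (fun r => f (b + r *: v)) (fun r => fv (b + r *: v)) _ _ s0.
- by move=> r; rewrite in_itv /= => /andP[r0 rs]; apply: ld; rewrite !ltW.
- apply: derivable_within_continuous => r; rewrite in_itv /= => rs.
  by have [] := ld r rs.
rewrite in_itv /= => /andP[r0 rs]; rewrite scale0r addr0 subr0 mulrC => e.
by exists r; rewrite ?ltW.
Qed.

(** The mean value theorem is applied twice: in direction [v] to [x |-> f (x + s w) - f x], then in
    direction [w] to [fv]. The bound on [s] keeps the whole parallelogram in the ball. *)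
Lemma second_difference (f fv fvw : V -> R) a v w (e s : R) :
  (forall x, ball a e x ->
     is_derive x v f (fv x) /\ is_derive x w fv (fvw x)) ->
  0 < s -> s * (`|v| + `|w|) < e ->
  exists2 y, ball a e y &
    f (a + s *: v + s *: w) - f (a + s *: v) - (f (a + s *: w) - f a)
    = s * (s * fvw y).
Proof.
move=> fd s0 se.
have inb r q : 0 <= r <= s -> 0 <= q <= s -> ball a e (a + r *: v + q *: w).
  move=> /andP[r0 rs] /andP[q0 qs].
  rewrite -ball_normE /= -addrA opprD addNKr normrN.
  apply: le_lt_trans se; rewrite mulrDr (le_trans (ler_normD _ _)) //.
  by rewrite !normrZ !ger0_norm // lerD // ler_wpM2r.
have ss : 0 <= s <= s by rewrite ltW /=.
have z0 : (0 : R) <= 0 <= s by rewrite lexx ltW.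
have dv r : 0 <= r <= s -> is_derive (a + r *: v) v (fun x => f (x + s *: w) - f x)
    ((fun x => fv (x + s *: w) - fv x) (a + r *: v)).
  move=> rs; apply: is_deriveB.
    by apply: is_derive_translate; have [] := fd _ (inb _ _ rs ss).
  by have [] := fd _ (inb _ _ rs z0); rewrite scale0r addr0.
have [r rs ->] := @MVT_line (fun x => f (x + s *: w) - f x)
  (fun x => fv (x + s *: w) - fv x) a v s s0 dv.
have dw q : 0 <= q <= s ->
    is_derive (a + r *: v + q *: w) w fv (fvw (a + r *: v + q *: w)).
  by move=> qs; have [] := fd _ (inb _ _ rs qs).
have [q qs ->] := @MVT_line fv fvw (a + r *: v) w s s0 dw.
by exists (a + r *: v + q *: w) => //; exact: inb.
Qed.

(** Schwarz's theorem. The second difference over a small parallelogram is symmetric in [v] and [w],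
    so some value of [fvw] near [a] equals some value of [fwv] near [a]; continuity at [a]
    concludes. *)
Lemma mixed_derivative_comm (f fv fw fvw fwv : V -> R) a v w :
  (\forall x \near a, is_derive x v f (fv x) /\ is_derive x w fv (fvw x)) ->
  (\forall x \near a, is_derive x w f (fw x) /\ is_derive x v fw (fwv x)) ->
  {for a, continuous fvw} -> {for a, continuous fwv} -> fvw a = fwv a.
Proof.
move=> nv nw cv cw; apply/eqP; rewrite -subr_eq0 -normr_le0; apply/ler_addgt0Pr => e e0.
rewrite add0r.
have e2 : 0 < e / 2 by rewrite divr_gt0.
have {}cv : \forall x \near a, `|fvw a - fvw x| < e / 2 by move/cvgrPdist_lt: cv; apply.
have {}cw : \forall x \near a, `|fwv a - fwv x| < e / 2 by move/cvgrPdist_lt: cw; apply.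
have : \forall x \near a, [/\ is_derive x v f (fv x) /\ is_derive x w fv (fvw x),
    is_derive x w f (fw x) /\ is_derive x v fw (fwv x),
    `|fvw a - fvw x| < e / 2 & `|fwv a - fwv x| < e / 2].
  by near=> x; split; near: x.
move=> /nbhs_ballP[d /= d0 dP].
(* The summand 1 keeps [c] positive when both directions vanish, and makes the bound [sd] strict. *)
pose c := `|v| + `|w| + 1; have c0 : 0 < c by rewrite ltr_wpDl // addr_ge0.
pose s := d / c; have s0 : 0 < s by rewrite divr_gt0.
have sd : s * (`|v| + `|w|) < d.
  by rewrite mulrAC ltr_pdivrMr // ltr_pM2l // /c ltrDl.
have sd' : s * (`|w| + `|v|) < d by rewrite addrC.
have dvw x : ball a d x -> is_derive x v f (fv x) /\ is_derive x w fv (fvw x).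
  by move=> /dP[].
have dwv x : ball a d x -> is_derive x w f (fw x) /\ is_derive x v fw (fwv x).
  by move=> /dP[].
have [y yd ey] := second_difference dvw s0 sd.
have [z zd ez] := second_difference dwv s0 sd'.
have yz : fvw y = fwv z.
  have sn : s != 0 by rewrite gt_eqF.
  apply: (mulfI sn); apply: (mulfI sn); rewrite -ey -ez -!addrA [s *: w + _]addrC; ring.
have [_ _ hy _] := dP _ yd; have [_ _ _ hz] := dP _ zd.
rewrite (_ : fvw a - fwv a = (fvw a - fvw y) - (fwv a - fwv z)); last by rewrite yz; ring.
rewrite (le_trans (ler_normB _ _)) // [leRHS](splitr e) lerD //; exact: ltW.
Unshelve. all: by end_near. Qed.

End MixedDerivatives.

(** * The stability identity at a point of a hypersurface frame *)

Section Frame.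
Context {R : realType} {m : nat}.
Variables (E N : 'M[R]_(m, m.+1)) (nu : 'rV[R]_m.+1).
Let G := E *m E^T.
Let g := invmx G.
Hypothesis Gunit : G \in unitmx.
Hypothesis nunu : nu *m nu^T = 1%:M.
Hypothesis Enu : E *m nu^T = 0.

(** The shape operator, extended by 0 to the normal line, as an ambient matrix acting on row
    vectors. The rows of [E] and [N] stand for the partial derivatives of the position and of the
    normal. *)
Definition weingarten := E^T *m invmx (E *m E^T) *m N.
Let S := weingarten.

Lemma gram_sym : G^T = G. Proof. by rewrite trmx_mul trmxK. Qed.

Lemma inv_gram_sym : g^T = g. Proof. by rewrite trmx_inv gram_sym. Qed.

(** The square matrix with rows [nu] and [E] has an explicit right inverse, which is also a left
    inverse; the second identity splits the ambient space into normal and tangent parts. *)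
Lemma frame_projection : E^T *m g *m E = 1%:M - nu^T *m nu.
Proof.
pose M : 'M[R]_(1 + m, m.+1) := col_mx nu E.
pose D : 'M[R]_(1 + m) := block_mx 1%:M 0 0 g.
have nuE : nu *m E^T = 0 by apply: trmx_inj; rewrite trmx_mul trmxK Enu trmx0.
have /mulmx1C : M *m (M^T *m D) = 1%:M :> 'M[R]_(1 + m).
  rewrite mulmxA tr_col_mx mul_col_row nunu nuE Enu mulmx_block.
  by rewrite !(mul0mx, mulmx0, mul1mx, addr0, add0r) mulmxV // -scalar_mx_block.
rewrite tr_col_mx mul_row_block mul_row_col !(mulmx0, mulmx1, addr0, add0r) => <-.
by rewrite addrAC subrr add0r.
Qed.

Hypothesis Nnu : N *m nu^T = 0.

Let b := N *m E^T.
Hypothesis bsym : b^T = b.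

Lemma frame_projectionl (v : 'rV[R]_m.+1) :
  v *m E^T *m g *m E = v - (v *m nu^T) *m nu.
Proof.
by rewrite -!mulmxA mulmxA -mulmxA (mulmxA E^T) frame_projection mulmxBr mulmx1 mulmxA.
Qed.

Lemma normal_projection : N *m E^T *m g *m E = N.
Proof.
by rewrite -!mulmxA (mulmxA E^T) frame_projection mulmxBr mulmx1 mulmxA Nnu mul0mx subr0.
Qed.

Lemma weingarten_normal : S *m nu^T = 0.
Proof. by rewrite /S /weingarten -mulmxA Nnu mulmx0. Qed.

Lemma weingarten_trace : \tr S = \tr (g *m b).
Proof. by rewrite /S /weingarten -mulmxA mxtrace_mulC mulmxA. Qed.

Lemma weingarten_sqnorm : \tr (S *m S^T) = \tr (g *m (N *m N^T)).
Proof.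
rewrite /S /weingarten !trmx_mul trmxK trmx_inv gram_sym -/G -/g.
by rewrite -!mulmxA mxtrace_mulC !mulmxA -(mulmxA _ E) mulmxKV // mulmxA.
Qed.

(** The right-hand side is the contraction g^ik g^jl A_ij A_kl that defines |A|^2 in coordinates. *)
Lemma weingarten_sqnorm_coef : \tr (g *m (N *m N^T)) = \tr (g *m b *m (g *m b)).
Proof.
have bT : E *m N^T = b by rewrite -bsym trmx_mul trmxK.
by rewrite -{1}normal_projection -(mulmxA _ E) bT -/b !mulmxA.
Qed.

Lemma sum_mul_inv_gram (A : 'M[R]_m) : \sum_i \sum_j g i j * A i j = \tr (g *m A).
Proof.
rewrite exchange_big; apply: eq_bigr => i _; rewrite mxE; apply: eq_bigr => j _.
by rewrite -{1}inv_gram_sym mxE.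
Qed.

(** * The Laplacian of the unit normal, from second partial derivatives *)

Variables (X2 N2 : 'I_m -> 'I_m -> 'rV[R]_m.+1).
Let dE l := \matrix_i X2 l i.
Let dN l := \matrix_i N2 l i.
Let db l := dN l *m E^T + N *m (dE l)^T.
Let dG l := dE l *m E^T + E *m (dE l)^T.
Hypothesis X2sym : forall i j, X2 i j = X2 j i.
Hypothesis N2sym : forall i j, N2 i j = N2 j i.
Hypothesis dbsym : forall i, (db i)^T = db i.
Hypothesis dEnu : forall i, dE i *m nu^T + E *m (row i N)^T = 0.
Hypothesis dNnu : forall i, dN i *m nu^T + N *m (row i N)^T = 0.

(** The left-hand trace is dH/du^l, by the product rule for [g b] with [dg = - g dG g]. Both halves
    of [dG] contribute the same trace, and one of them cancels against the term [N (dE l)^T] of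
    [db]. *)
Lemma mean_curvature_variation l :
  \tr (- (g *m dG l *m g) *m b + g *m db l) =
  \tr (g *m (dN l *m E^T - dE l *m N^T)).
Proof.
have bT : E *m N^T = b by rewrite -bsym trmx_mul trmxK.
have e1 : \tr (g *m (dE l *m E^T) *m g *m b) = \tr (g *m (dE l *m N^T)).
  have := congr1 trmx normal_projection; rewrite !trmx_mul trmxK inv_gram_sym bT.
  by move=> <-; rewrite !mulmxA.
have e2 : \tr (g *m (E *m (dE l)^T) *m g *m b) = \tr (g *m (dE l *m N^T)).
  rewrite -e1 -mxtrace_tr trmx_mul bsym !trmx_mul !trmxK inv_gram_sym.
  by rewrite mulmxA mxtrace_mulC !mulmxA mxtrace_mulC !mulmxA.
have e3 : \tr (g *m (N *m (dE l)^T)) = \tr (g *m (dE l *m N^T)).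
  by rewrite -mxtrace_tr !trmx_mul !trmxK inv_gram_sym mxtrace_mulC.
rewrite /db /dG !(mulNmx, mulmxDr, mulmxDl, mulmxN, raddfD, raddfN) /= e1 e2 e3.
ring.
Qed.

(** The Laplacian of the normal: [X2 i j *m S] is the Christoffel term, the sum over k of Gamma^k_ij
    times [row k N]. *)
Let LN : 'rV[R]_m.+1 := \sum_i \sum_j g i j *: (N2 i j - X2 i j *m S).

Lemma row_dN i j : row j (dN i) = N2 i j. Proof. by rewrite rowK. Qed.

Lemma row_dE i j : row j (dE i) = X2 i j. Proof. by rewrite rowK. Qed.

Lemma db_dotE i j l :
  db i j l = dot (N2 i j) (row l E) + dot (row j N) (X2 i l).
Proof. by rewrite /db mxE !mulmx_trE !rowK. Qed.

(** The tangential half of the formula for Delta nu: its product with [row l E] is dH/du^l. The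
    Codazzi equation, in the form of the symmetry of [db i], exchanges [j] and [l]; symmetry of [X2]
    and [N2] then makes [l] the index of differentiation. *)
Lemma laplacian_normal_tangential l :
  (LN *m E^T) 0 l = \tr (- (g *m dG l *m g) *m b + g *m db l).
Proof.
rewrite mean_curvature_variation -sum_mul_inv_gram /LN mulmx_suml summxE.
apply: eq_bigr => i _; rewrite mulmx_suml summxE; apply: eq_bigr => j _.
rewrite -scalemxAl mxE; congr (_ * _).
have SE : S *m E^T = E^T *m g *m E *m N^T.
  by rewrite /S /weingarten -!mulmxA -[N *m E^T]/b -bsym trmx_mul trmxK.
rewrite mulmxBl -mulmxA SE frame_projection // mulmxBl mul1mx -mulmxA.
have -> : nu *m N^T = 0 by apply: trmx_inj; rewrite trmx_mul trmxK Nnu trmx0.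
rewrite mulmx0 subr0.
have := congr1 (fun M : 'M[R]_m => M j l) (dbsym i).
rewrite mxE !db_dotE (N2sym i l) (X2sym i l) => codazzi.
rewrite [LHS]mxE [X in _ + X]mxE [RHS]mxE [X in _ = _ + X]mxE !mulmx_trE !row_id.
rewrite !row_dN !row_dE (dotC (X2 i j)) (dotC (X2 l i)).
by apply/eqP; rewrite subr_eq addrAC -subr_eq opprK codazzi.
Qed.

Variables (X : 'rV[R]_m.+1) (h : R).
Hypothesis hE : h = \tr (g *m b) + 2^-1 * dot X nu.
Hypothesis dh : forall l,
  \tr (- (g *m dG l *m g) *m b + g *m db l) = - (2^-1 * dot X (row l N)).

(** By [dNnu], the product of [N2 i j] with [nu] is minus that of rows [i] and [j] of [N], while the
    Christoffel term is tangential. *)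
Lemma laplacian_normal_normal : dot LN nu = - \tr (S *m S^T).
Proof.
rewrite weingarten_sqnorm -sum_mul_inv_gram /LN dot_suml -sumrN.
apply: eq_bigr => i _; rewrite dot_suml -sumrN; apply: eq_bigr => j _.
rewrite dotZl -mulrN; congr (_ * _).
rewrite dotBl (dotE (_ *m S)) -mulmxA weingarten_normal // mulmx0 mxE subr0.
have := congr1 (fun M : 'M[R]_(m, 1) => M j 0) (dNnu i).
rewrite [LHS]mxE [RHS]mxE !mulmx_trE !row_id row_dN => /eqP.
by rewrite addr_eq0 => /eqP ->; rewrite dotC.
Qed.

(** This is A(xT, xT) for the position vector [X]. *)
Let q := dot (X *m N^T *m g *m E) X.

(** The tangential and normal parts of [LN] are paired with [X] separately; [dh] carries the
    constancy of the weighted mean curvature. *)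
Lemma laplacian_normal_position :
  dot LN X = - (2^-1 * q) - \tr (S *m S^T) * dot X nu.
Proof.
have LE : LN *m E^T = (- 2^-1) *: (X *m N^T).
  apply/rowP => l; rewrite laplacian_normal_tangential dh -mulNr.
  by rewrite [RHS]mxE mulmx_trE row_id.
have {1}-> : LN = LN *m E^T *m g *m E + (LN *m nu^T) *m nu.
  by rewrite frame_projectionl // subrK.
rewrite dotDl LE -!scalemxAl dotZl -/q mulNr.
rewrite (mx11_scalar (LN *m nu^T)) -dotE laplacian_normal_normal.
by rewrite mul_scalar_mx dotZl mulNr (dotC nu).
Qed.

Lemma dE_normal i j : dot (X2 i j) nu = - b i j.
Proof.
have := congr1 (fun M : 'M[R]_(m, 1) => M j 0) (dEnu i).
rewrite [LHS]mxE [RHS]mxE !mulmx_trE !row_id row_dE => /eqP.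
by rewrite addr_eq0 => /eqP ->; rewrite dotC.
Qed.

(** The row of first partial derivatives of F = V - h <x, nu>. *)
Let d : 'rV[R]_m := X *m E^T - h *: (X *m N^T).

(** The left-hand side is the Hessian of F. Its Christoffel terms remove the tangential part of
    [X2 i j], and by the Gauss formula the normal part is [- b i j] times [nu]. *)
Lemma stability_summand i j :
  G i j + dot X (X2 i j) - h * (dot (row i E) (row j N) + dot X (N2 i j))
   - \sum_k (X2 i j *m E^T *m g) 0 k * d 0 k
  = G i j - (dot X nu + h) * b i j - h * dot (N2 i j - X2 i j *m S) X.
Proof.
have -> : dot (row i E) (row j N) = b i j.
  have bT : E *m N^T = b by rewrite -bsym trmx_mul trmxK.
  by rewrite -mulmx_trE bT.
rewrite -/(dot _ d) (dotC _ d) /d dotBl dotZl !dot_mulmx !trmxK.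
rewrite ![dot X (_ *m _)]dotC frame_projectionl // dotBl.
rewrite (mx11_scalar (X2 i j *m nu^T)) -dotE dE_normal mul_scalar_mx dotZl.
rewrite -!mulmxA (mulmxA E^T) -/(weingarten) -/S dotBl (dotC nu).
rewrite (dotC X (X2 i j)) (dotC X (N2 i j)); ring.
Qed.

(** Delta nu contributes [h q / 2] and the drift term [- h q / 2], so A(xT, xT) drops out; likewise
    h |A|^2 <x, nu> cancels against the zeroth-order term. The rest follows from H = h - <x, nu> /
    2. *)
Lemma stability_identity :
  \sum_i \sum_j g i j * (G i j + dot X (X2 i j)
    - h * (dot (row i E) (row j N) + dot X (N2 i j))
    - \sum_k (X2 i j *m E^T *m g) 0 k * d 0 k)
  + 2^-1 * dot (X - dot X nu *: nu) (d *m g *m E)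
  + (\tr (S *m S^T) - 2^-1) * (m%:R + dot X X / 2 - h * dot X nu)
  = (\tr (S *m S^T) + 2^-1) * (m%:R + dot X X / 2) - h ^+ 2.
Proof.
have -> : \sum_i \sum_j g i j * (G i j + dot X (X2 i j)
    - h * (dot (row i E) (row j N) + dot X (N2 i j))
    - \sum_k (X2 i j *m E^T *m g) 0 k * d 0 k) =
  m%:R - (dot X nu + h) * \tr (g *m b) - h * dot LN X.
  rewrite -(mxtrace1 R m) -(mulVmx Gunit) -!sum_mul_inv_gram.
  rewrite /LN dot_suml !mulr_sumr -!sumrB; apply: eq_bigr => i _.
  rewrite dot_suml !mulr_sumr -!sumrB; apply: eq_bigr => j _.
  by rewrite stability_summand dotZl; ring.
have -> : dot (X - dot X nu *: nu) (d *m g *m E) =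
    dot X X - dot X nu ^+ 2 - h * q.
  have nuE : nu *m E^T = 0 by apply: trmx_inj; rewrite trmx_mul trmxK Enu trmx0.
  rewrite dotC dot_mulmx [(X - _) *m _]mulmxBl -scalemxAl nuE scaler0 subr0 -dot_mulmx.
  rewrite /d mulmxBl mulmxBl -!scalemxAl frame_projectionl // !dotBl dotZl -/q.
  rewrite (mx11_scalar (X *m nu^T)) -dotE mul_scalar_mx dotZl (dotC nu); ring.
by rewrite laplacian_normal_position hE; field.
Qed.

End Frame.

(** * Hypersurfaces parametrized by an open set *)

Lemma near_eq_is_derive_eq (R : numFieldType) (V W : normedModType R)
    (f g : V -> W) t v df dg :
  (\forall x \near t, f x = g x) -> is_derive t v f df -> is_derive t v g dg ->
  df = dg.
Proof.
move=> fg fd [_ <-]; have [_ <-] := fd.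
exact: near_eq_derive.
Qed.

(** * Coordinate frames of a smooth map and their derivatives *)

Section SmoothFrames.
Context {R : realType} {m n : nat}.
Implicit Types (U : set 'rV[R]_m) (f : 'rV[R]_m -> 'rV[R]_n).

Definition frame f u : 'M[R]_(m, n) := \matrix_i 'D_(delta_mx 0 i) f u.

Lemma row_frame f u i : row i (frame f u) = 'D_(delta_mx 0 i) f u.
Proof. by rewrite rowK. Qed.

Lemma smooth_on_is_derive (W : normedModType R) U (f : 'rV[R]_m -> W) u v :
  smooth_on U f -> U u -> is_derive u v f ('D_v f u).
Proof.
by move=> /(_ [::] u) /= fs /fs fd; apply/derivableP/diff_derivable.
Qed.

Lemma smooth_on_partial (W : normedModType R) U (f : 'rV[R]_m -> W) i :
  smooth_on U f -> smooth_on U ('D_(delta_mx 0 i) f).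
Proof.
move=> fs s u Uu; have := fs (rcons s i) u Uu.
by rewrite /iter_partial foldr_rcons.
Qed.

Lemma smooth_on_continuous (W : normedModType R) U (f : 'rV[R]_m -> W) u :
  smooth_on U f -> U u -> {for u, continuous f}.
Proof. by move=> /(_ [::] u) /= fs /fs; exact: differentiable_continuous. Qed.

Lemma mixed_partial_comm U f i j u : open U -> smooth_on U f -> U u ->
  'D_(delta_mx 0 i) ('D_(delta_mx 0 j) f) u =
  'D_(delta_mx 0 j) ('D_(delta_mx 0 i) f) u.
Proof.
move=> Uo fs Uu; apply/rowP => k.
have nU : \forall x \near u, U x by exact: open_nbhs_nbhs.
have D k1 k2 x : U x ->
    is_derive x (delta_mx 0 k1) (fun x => f x 0 k) ('D_(delta_mx 0 k1) f x 0 k) /\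
    is_derive x (delta_mx 0 k2) (fun x => 'D_(delta_mx 0 k1) f x 0 k)
      ('D_(delta_mx 0 k2) ('D_(delta_mx 0 k1) f) x 0 k).
  move=> Ux; split; last have fs1 := smooth_on_partial k1 fs.
    by have /is_derive_mxP := smooth_on_is_derive (delta_mx 0 k1) fs Ux; apply.
  by have /is_derive_mxP := smooth_on_is_derive (delta_mx 0 k2) fs1 Ux; apply.
have C k1 k2 : {for u, continuous
    (fun x => 'D_(delta_mx 0 k1) ('D_(delta_mx 0 k2) f) x 0 k)}.
  apply: (@continuous_comp _ _ _ ('D_(delta_mx 0 k1) ('D_(delta_mx 0 k2) f))
    (fun M : 'rV[R]_n => M 0 k)); last exact: coord_continuous.
  by apply: (smooth_on_continuous _ Uu); do 2 apply: smooth_on_partial.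
apply: (@mixed_derivative_comm _ _ (fun x => f x 0 k)
  (fun x => 'D_(delta_mx 0 j) f x 0 k) (fun x => 'D_(delta_mx 0 i) f x 0 k)
  (fun x => 'D_(delta_mx 0 i) ('D_(delta_mx 0 j) f) x 0 k)
  (fun x => 'D_(delta_mx 0 j) ('D_(delta_mx 0 i) f) x 0 k)
  u (delta_mx 0 j) (delta_mx 0 i)).
- by near=> x; apply: D; near: x.
- by near=> x; apply: D; near: x.
- exact: C.
- exact: C.
Unshelve. all: by end_near. Qed.

Lemma is_derive_frame U f i u : smooth_on U f -> U u ->
  is_derive u (delta_mx 0 i) (frame f)
    (\matrix_j 'D_(delta_mx 0 i) ('D_(delta_mx 0 j) f) u).
Proof.
move=> fs Uu; apply/is_derive_mxP => j k; rewrite mxE.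
rewrite (_ : (fun _ => _) = fun x => 'D_(delta_mx 0 j) f x 0 k).
  have fs1 := smooth_on_partial j fs.
  by have /is_derive_mxP := smooth_on_is_derive (delta_mx 0 i) fs1 Uu; apply.
by apply/funext => x; rewrite mxE.
Qed.

End SmoothFrames.

(** [A], [B] and [C] are derivatives of metric coefficients expanded by the product rule; symmetry
    of [Y] reduces [A + B - C] to twice the product of [Y i j] with [e l]. *)
Lemma koszul (R : realType) m n (Y : 'I_m -> 'I_m -> 'rV[R]_n) (e : 'I_m -> 'rV[R]_n)
    i j l (a A B C : R) :
  (forall i j, Y i j = Y j i) ->
  A = dot (Y i j) (e l) + dot (e j) (Y i l) ->
  B = dot (Y j i) (e l) + dot (e i) (Y j l) ->
  C = dot (Y l i) (e j) + dot (e i) (Y l j) ->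
  2^-1 * (a * (A + B - C)) = dot (Y i j) (e l) * a.
Proof.
move=> Ysym -> -> ->; rewrite (Ysym j i) (Ysym l i) (Ysym l j) (dotC (e j)).
by field.
Qed.

Section LocalHypersurface.
Context {R : realType} {m : nat}.
Variables (U : set 'rV[R]_m) (X N : 'rV[R]_m -> 'rV[R]_m.+1) (h : R).
Hypotheses (Uopen : open U) (Xsmooth : smooth_on U X) (Nsmooth : smooth_on U N).
Hypothesis N_unit : forall u, U u -> dot (N u) (N u) = 1.
Hypothesis N_normal : forall u, U u -> frame X u *m (N u)^T = 0.
Hypothesis gram_unit : forall u, U u -> frame X u *m (frame X u)^T \in unitmx.

Let E u := frame X u.
Let F u := frame N u.
Let X2 i j u := 'D_(delta_mx 0 i) ('D_(delta_mx 0 j) X) u.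
Let N2 i j u := 'D_(delta_mx 0 i) ('D_(delta_mx 0 j) N) u.

Lemma near_open u : U u -> \forall x \near u, U x.
Proof. by move=> Uu; exact: open_nbhs_nbhs. Qed.

Let constR (f : 'rV[R]_m -> R) c u v df :
  (forall x, U x -> f x = c) -> U u -> is_derive u v f df -> df = 0.
Proof.
move=> fc Uu fd; apply: (near_eq_is_derive_eq (g := cst c) _ fd).
by apply: filterS (near_open Uu).
Qed.

Let constM p q (f : 'rV[R]_m -> 'M[R]_(p, q)) c u v df :
  (forall x, U x -> f x = c) -> U u -> is_derive u v f df -> df = 0.
Proof.
move=> fc Uu fd; apply: (near_eq_is_derive_eq (g := cst c) _ fd).
by apply: filterS (near_open Uu).
Qed.

Let eqM p q (f g : 'rV[R]_m -> 'M[R]_(p, q)) u v df dg :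
  (forall x, U x -> f x = g x) -> U u ->
  is_derive u v f df -> is_derive u v g dg -> df = dg.
Proof.
move=> fg Uu; apply: near_eq_is_derive_eq.
by apply: filterS (near_open Uu).
Qed.

Lemma dot_normal_partial u j : U u -> dot (N u) ('D_(delta_mx 0 j) X u) = 0.
Proof.
move=> Uu; rewrite dotC -row_frame.
have := congr1 (fun M : 'M[R]_(m, 1) => M j 0) (N_normal Uu).
by rewrite mulmx_trE row_id mxE.
Qed.

Lemma frame_normal_normal u : U u -> frame N u *m (N u)^T = 0.
Proof.
move=> Uu; apply/colP => j; rewrite mulmx_trE row_id row_frame mxE.
have d := is_derive_dot (smooth_on_is_derive (delta_mx 0 j) Nsmooth Uu)
  (smooth_on_is_derive (delta_mx 0 j) Nsmooth Uu).
have := constR N_unit Uu d.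
by rewrite [X in _ + X]dotC -mulr2n => /eqP; rewrite mulrn_eq0 => /eqP.
Qed.

Lemma frame_normal_variation u i : U u ->
  (\matrix_j X2 i j u) *m (N u)^T + E u *m (row i (F u))^T = 0.
Proof.
move=> Uu; rewrite row_frame.
have d := is_derive_mulmx (is_derive_frame i Xsmooth Uu)
  (is_derive_trmx (smooth_on_is_derive (delta_mx 0 i) Nsmooth Uu)).
exact: constM N_normal Uu d.
Qed.

Lemma normal_frame_variation u i : U u ->
  (\matrix_j N2 i j u) *m (N u)^T + F u *m (row i (F u))^T = 0.
Proof.
move=> Uu; rewrite row_frame.
have d := is_derive_mulmx (is_derive_frame i Nsmooth Uu)
  (is_derive_trmx (smooth_on_is_derive (delta_mx 0 i) Nsmooth Uu)).
exact: constM frame_normal_normal Uu d.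
Qed.

(** Differentiating the orthogonality of frame and normal expresses each coefficient as minus the
    normal component of a second partial of [X], and these partials commute. *)
Lemma second_form_sym u : U u -> (F u *m (E u)^T)^T = F u *m (E u)^T.
Proof.
move=> Uu; apply/matrixP => i j.
have h1 k l : dot (row k (E u)) (row l (F u)) = - dot (X2 l k u) (N u).
  have := congr1 (fun M : 'M[R]_(m, 1) => M k 0) (frame_normal_variation l Uu).
  rewrite [LHS]mxE [RHS]mxE !mulmx_trE !row_id rowK => /eqP.
  by rewrite addrC addr_eq0 => /eqP.
rewrite mxE !mulmx_trE dotC h1 [RHS]dotC h1.
exact: (congr1 (fun y => - dot y (N u)) (mixed_partial_comm j i Uopen Xsmooth Uu)).
Qed.

Lemma is_derive_second_form u i : U u ->
  is_derive u (delta_mx 0 i) (fun x => F x *m (E x)^T)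
    ((\matrix_j N2 i j u) *m (E u)^T + F u *m (\matrix_j X2 i j u)^T).
Proof.
move=> Uu; apply: is_derive_mulmx; first exact: is_derive_frame Uu.
by apply: is_derive_trmx; exact: is_derive_frame Uu.
Qed.

Lemma codazzi u i : U u ->
  let db := (\matrix_j N2 i j u) *m (E u)^T + F u *m (\matrix_j X2 i j u)^T in
  db^T = db.
Proof.
move=> Uu db; have d := is_derive_second_form i Uu.
exact: (eqM second_form_sym Uu (is_derive_trmx d) d).
Qed.

Lemma is_derive_gram u i : U u ->
  is_derive u (delta_mx 0 i) (fun x => E x *m (E x)^T)
    ((\matrix_j X2 i j u) *m (E u)^T + E u *m (\matrix_j X2 i j u)^T).
Proof.
move=> Uu; apply: is_derive_mulmx; first exact: is_derive_frame Uu.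
by apply: is_derive_trmx; exact: is_derive_frame Uu.
Qed.

Hypothesis cmc : forall u, U u ->
  \tr (invmx (E u *m (E u)^T) *m (F u *m (E u)^T)) + 2^-1 * dot (X u) (N u) = h.

Lemma mean_curvature_derivative u l : U u ->
  \tr (- (invmx (E u *m (E u)^T) *m ((\matrix_j X2 l j u) *m (E u)^T
      + E u *m (\matrix_j X2 l j u)^T) *m invmx (E u *m (E u)^T))
      *m (F u *m (E u)^T)
    + invmx (E u *m (E u)^T) *m ((\matrix_j N2 l j u) *m (E u)^T
      + F u *m (\matrix_j X2 l j u)^T)) = - (2^-1 * dot (X u) (row l (F u))).
Proof.
move=> Uu.
have nearG : \forall x \near u, E x *m (E x)^T \in unitmx.
  by apply: filterS (near_open Uu) => x; exact: gram_unit.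
have dg := is_derive_invmx nearG (is_derive_gram l Uu).
have dH := is_derive_mxtrace (is_derive_mulmx dg (is_derive_second_form l Uu)).
have ds := is_derive_dot (smooth_on_is_derive (delta_mx 0 l) Xsmooth Uu)
  (smooth_on_is_derive (delta_mx 0 l) Nsmooth Uu).
have := constR cmc Uu (is_deriveD dH (is_deriveZ 2^-1 ds)).
rewrite (dotC ('D_ _ X u)) dot_normal_partial // add0r row_frame.
by move/eqP; rewrite addr_eq0 => /eqP.
Qed.

(** The Levi-Civita connection of the induced metric is the tangential part of the ambient one:
    Gamma^k_ij is the k-th coordinate of the tangential part of [X2 i j u]. *)
Lemma christoffel_frame u k i j : U u ->
  2^-1 * \sum_l invmx (E u *m (E u)^T) k l *
    ('D_(delta_mx 0 i) (fun x => dot ('D_(delta_mx 0 j) X x) ('D_(delta_mx 0 l) X x)) u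
     + 'D_(delta_mx 0 j) (fun x => dot ('D_(delta_mx 0 i) X x) ('D_(delta_mx 0 l) X x)) u
     - 'D_(delta_mx 0 l) (fun x => dot ('D_(delta_mx 0 i) X x) ('D_(delta_mx 0 j) X x)) u)
  = (X2 i j u *m (E u)^T *m invmx (E u *m (E u)^T)) 0 k.
Proof.
move=> Uu; rewrite mulr_sumr [RHS]mxE; apply: eq_bigr => l _.
have d a b c :
   'D_(delta_mx 0 a) (fun x => dot ('D_(delta_mx 0 b) X x) ('D_(delta_mx 0 c) X x)) u
   = dot (X2 a b u) ('D_(delta_mx 0 c) X u) + dot ('D_(delta_mx 0 b) X u) (X2 a c u).
  apply: derive_val; apply: is_derive_dot.
    exact: smooth_on_is_derive (smooth_on_partial b Xsmooth) Uu.
  exact: smooth_on_is_derive (smooth_on_partial c Xsmooth) Uu.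
have s a b : X2 a b u = X2 b a u := mixed_partial_comm a b Uopen Xsmooth Uu.
rewrite mulmx_trE row_id row_frame -[in RHS]inv_gram_sym [X in _ = _ * X]mxE.
exact: (koszul (Y := fun a b => X2 a b u) (e := fun k => 'D_(delta_mx 0 k) X u) _ s
  (d i j l) (d j i l) (d l i j)).
Qed.

Let f u := m%:R + dot (X u) (X u) / 2 - h * dot (X u) (N u).

Lemma is_derive_potential u j : U u -> is_derive u (delta_mx 0 j) f
   (dot (X u) ('D_(delta_mx 0 j) X u) - h * dot (X u) ('D_(delta_mx 0 j) N u)).
Proof.
move=> Uu.
have dX := smooth_on_is_derive (delta_mx 0 j) Xsmooth Uu.
have dN := smooth_on_is_derive (delta_mx 0 j) Nsmooth Uu.
have dc : is_derive u (delta_mx 0 j) (cst (m%:R : R)) 0 by exact: is_derive_cst.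
have := is_deriveB (is_deriveD dc
  (is_deriveZ 2^-1 (is_derive_dot dX dX))) (is_deriveZ h (is_derive_dot dX dN)).
rewrite (_ : _ - _ = f :> ('rV[R]_m -> R)); last first.
  by apply/funext => x; rewrite /f mulrC.
move=> d; apply: is_derive_eq d _.
rewrite /GRing.scale /= !(dotC ('D_ _ X u)) [dot (N u) _]dot_normal_partial //; by field.
Qed.

Lemma second_derivative_potential u i j : U u ->
  'D_(delta_mx 0 i) ('D_(delta_mx 0 j) f) u =
  dot ('D_(delta_mx 0 i) X u) ('D_(delta_mx 0 j) X u) + dot (X u) (X2 i j u)
  - h * (dot ('D_(delta_mx 0 i) X u) ('D_(delta_mx 0 j) N u) + dot (X u) (N2 i j u)).
Proof.
move=> Uu.
have dX := smooth_on_is_derive (delta_mx 0 i) Xsmooth Uu.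
have dXj := smooth_on_is_derive (delta_mx 0 i) (smooth_on_partial j Xsmooth) Uu.
have dNj := smooth_on_is_derive (delta_mx 0 i) (smooth_on_partial j Nsmooth) Uu.
rewrite (@near_eq_derive _ _ _ _ (fun x => dot (X x) ('D_(delta_mx 0 j) X x)
    - h * dot (X x) ('D_(delta_mx 0 j) N x))).
  apply: derive_val.
  exact: is_deriveB (is_derive_dot dX dXj) (is_deriveZ h (is_derive_dot dX dNj)).
apply: filterS (near_open Uu) => x Ux.
by have [_ <-] := is_derive_potential j Ux.
Qed.

Lemma local_stability u : U u ->
  let g := invmx (E u *m (E u)^T) in
  let A2 := \tr (weingarten (E u) (F u) *m (weingarten (E u) (F u))^T) in
  \sum_i \sum_j g i j * ('D_(delta_mx 0 i) ('D_(delta_mx 0 j) f) u -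
    \sum_k (X2 i j u *m (E u)^T *m g) 0 k * 'D_(delta_mx 0 k) f u)
  + 2^-1 * dot (X u - dot (X u) (N u) *: N u)
      (\sum_i \sum_j (g i j * 'D_(delta_mx 0 i) f u) *: row j (E u))
  + (A2 - 2^-1) * f u
  = (A2 + 2^-1) * (m%:R + dot (X u) (X u) / 2) - h ^+ 2.
Proof.
move=> Uu g A2.
have nunu : N u *m (N u)^T = 1%:M.
  by rewrite [LHS]mx11_scalar -dotE N_unit.
have key := stability_identity (gram_unit Uu) nunu (N_normal Uu)
  (frame_normal_normal Uu) (second_form_sym Uu)
  (fun i j => mixed_partial_comm i j Uopen Xsmooth Uu)
  (fun i j => mixed_partial_comm i j Uopen Nsmooth Uu)
  (fun i => codazzi i Uu) (fun i => frame_normal_variation i Uu)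
  (fun i => normal_frame_variation i Uu) (esym (cmc Uu))
  (fun l => mean_curvature_derivative l Uu).
set d := X u *m (E u)^T - h *: (X u *m (F u)^T) in key.
have df k : 'D_(delta_mx 0 k) f u = d 0 k.
  have [_ ->] := is_derive_potential k Uu.
  by rewrite /d mxE [X in _ = _ + X]mxE [X in _ = _ - X]mxE !mulmx_trE !row_id !row_frame.
rewrite -key; congr (_ + _ * _ + _).
  apply: eq_bigr => i _; apply: eq_bigr => j _; congr (_ * (_ - _)).
    by rewrite second_derivative_potential // mulmx_trE !row_frame.
  by apply: eq_bigr => k _; rewrite df.
congr (dot _ _); rewrite [RHS]mulmx_sum_row exchange_big; apply: eq_bigr => j _.
rewrite -scaler_suml; congr (_ *: _); rewrite mxE.
by apply: eq_bigr => i _; rewrite df mulrC.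
Qed.

End LocalHypersurface.

(** * Charts of an immersed hypersurface *)

Lemma frame_jacobian (R : realType) m n (f : 'rV[R]_m -> 'rV[R]_n) u :
  differentiable f u -> frame f u = 'J f u.
Proof.
move=> fd; apply/row_matrixP => i.
by rewrite row_frame deriveEjacobian // -rowE.
Qed.

Lemma diff_frame (R : realType) m n (f : 'rV[R]_m -> 'rV[R]_n) u v :
  differentiable f u -> 'd f u v = v *m frame f u.
Proof. by move=> fd; rewrite frame_jacobian // -deriveEjacobian // deriveE. Qed.

Lemma gram_unitmx (R : realFieldType) p q (E : 'M[R]_(p, q)) :
  row_free E -> E *m E^T \in unitmx.
Proof.
move=> Efree; rewrite -row_free_unit; apply: inj_row_free => v vG.
suff vE0 : v *m E = 0 by apply: (row_free_inj Efree); rewrite vE0 mul0mx.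
have : (v *m E) *m (v *m E)^T = 0.
  by rewrite trmx_mul mulmxA -(mulmxA v) vG mul0mx.
move=> /(congr1 (fun M : 'M[R]_1 => M 0 0)); rewrite !mxE => /eqP.
rewrite psumr_eq0 => [/allP vE0|k _]; last by rewrite [_^T _ _]mxE -expr2 sqr_ge0.
apply/rowP => k; have /implyP/(_ isT) := vE0 k (mem_index_enum _).
by rewrite [_^T _ _]mxE mulf_eq0 orbb => /eqP ->; rewrite mxE.
Qed.

(** Metric and second fundamental form both change by congruence with the Jacobian [J] of a
    coordinate change; this makes H independent of the chart. *)
Lemma mxtrace_congruence (R : comUnitRingType) n (J G B : 'M[R]_n) :
  J \in unitmx -> G \in unitmx ->
  \tr (invmx (J *m G *m J^T) *m (J *m B *m J^T)) = \tr (invmx G *m B).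
Proof.
move=> Ju Gu; have JTu : J^T \in unitmx by rewrite unitmx_tr.
have -> : invmx (J *m G *m J^T) = invmx J^T *m invmx G *m invmx J.
  rewrite -[RHS](mulKmx (_ : J *m G *m J^T \in unitmx)) ?unitmx_mul ?Ju ?Gu //.
  by rewrite !mulmxA !mulmxK.
by rewrite mxtrace_mulC !mulmxA mulmxK // mxtrace_mulC !mulmxA mulVmx // mul1mx mxtrace_mulC.
Qed.

Section Charts.
Context {R : realType} {m : nat} {M : smoothManifold R m}.
Implicit Types (c : chart R m M) (p : M).

(** The inner partial is taken at [chart_map c (chart_inv c u)], which equals [u] only on
    [chart_cod c]; as this set is open, the two functions agree near the point. *)
Lemma chart_partial_partial (W : normedModType R) c i j (f : M -> W) p :
  chart_dom c p ->
  chart_partial c i (chart_partial c j f) p =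
  'D_(delta_mx 0 i) ('D_(delta_mx 0 j) (f \o chart_inv c)) (chart_map c p).
Proof.
move=> cp; apply: near_eq_derive.
have : \forall u \near chart_map c p, chart_cod c u.
  by apply: open_nbhs_nbhs; split; [exact: chart_cod_open|exact: chart_map_cod].
by apply: filterS => u cu; rewrite /= /chart_partial chart_invK.
Qed.

Lemma chart_partial_metric (x : M -> 'rV[R]_m.+1) c i j l p :
  chart_dom c p ->
  chart_partial c i (metric x c j l) p =
  'D_(delta_mx 0 i) (fun u => dot ('D_(delta_mx 0 j) (x \o chart_inv c) u)
     ('D_(delta_mx 0 l) (x \o chart_inv c) u)) (chart_map c p).
Proof.
move=> cp; apply: near_eq_derive.
have : \forall u \near chart_map c p, chart_cod c u.
  by apply: open_nbhs_nbhs; split; [exact: chart_cod_open|exact: chart_map_cod].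
by apply: filterS => u cu; rewrite /= /metric /chart_partial chart_invK.
Qed.

Lemma inv_metricE (x : M -> 'rV[R]_m.+1) c i j p :
  let E := frame (x \o chart_inv c) (chart_map c p) in
  inv_metric x c i j p = invmx (E *m E^T) i j.
Proof.
move=> E; rewrite /inv_metric; congr (invmx _ i j); apply/matrixP => k l.
by rewrite mulmx_trE mxE !row_frame.
Qed.

(** The chain rule for [(f \o chart_inv c) \o t], which agrees with [f \o chart_inv c'] near [u'],
    where [chart_inv c'] stays in the domain of [c]. *)
Lemma frame_transition n (f : M -> 'rV[R]_n) c c' p :
  atlas c -> atlas c' -> chart_dom c p -> chart_dom c' p -> smooth_map f ->
  frame (f \o chart_inv c') (chart_map c' p) =
  'J (chart_map c \o chart_inv c') (chart_map c' p) *m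
  frame (f \o chart_inv c) (chart_map c p).
Proof.
move=> ac ac' cp cp' fs; set u' := chart_map c' p; set t := chart_map c \o chart_inv c'.
have u'cod : chart_cod c' u' by exact: chart_map_cod.
have tu' : t u' = chart_map c p by rewrite /t /= chart_mapK.
have td : differentiable t u'.
  apply: (atlas_compatible ac' ac [::]); split => //.
  by rewrite /preimage /= chart_mapK.
have fd : differentiable (f \o chart_inv c) (t u').
  by rewrite tu'; apply: (fs c ac [::]); exact: chart_map_cod.
apply/row_matrixP => i; rewrite row_frame row_mul rowE -deriveEjacobian //.
rewrite -tu' -diff_frame // [in RHS](deriveE _ td).
rewrite (@near_eq_derive _ _ _ _ ((f \o chart_inv c) \o t)).
  rewrite (deriveE _ (differentiable_comp td fd)).
  exact: (congr1 (fun F => F (delta_mx 0 i)) (diff_comp td fd)).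
have : \forall u \near u', chart_dom c (chart_inv c' u).
  apply: (chart_inv_continuous u'cod); rewrite /= chart_mapK //.
  by apply: open_nbhs_nbhs; split => //; exact: chart_dom_open.
by apply: filterS => u cu; rewrite /= chart_mapK.
Qed.

Section Hypersurface.
Variables x nu : M -> 'rV[R]_m.+1.
Hypotheses (ximm : immersion x) (nunormal : unit_normal x nu).

Let X c := x \o chart_inv c.
Let N c := nu \o chart_inv c.

Lemma chart_smooth c : atlas c ->
  smooth_on (chart_cod c) (X c) /\ smooth_on (chart_cod c) (N c).
Proof. by move=> ac; have [xs _] := ximm; have [ns _ _] := nunormal; split; auto. Qed.

Lemma chart_normal_unit c u : dot (N c u) (N c u) = 1.
Proof. by have [_ + _] := nunormal; apply. Qed.

Lemma chart_normal c u : atlas c -> chart_cod c u ->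
  frame (X c) u *m (N c u)^T = 0.
Proof.
move=> ac cu; have [_ _ nd] := nunormal.
have [Xs _] := chart_smooth ac.
apply/colP => i; rewrite mulmx_trE row_id row_frame mxE dotC.
rewrite deriveE; last exact: (Xs [::]).
by rewrite -[X in 'd _ X](chart_invK cu) nd //; exact: chart_inv_dom.
Qed.

Lemma chart_gram_unit c u : atlas c -> chart_cod c u ->
  frame (X c) u *m (frame (X c) u)^T \in unitmx.
Proof.
move=> ac cu; apply: gram_unitmx; apply: inj_row_free => v.
have [Xs _] := chart_smooth ac; rewrite -diff_frame; last exact: (Xs [::]).
have [_ inj] := ximm; have := inj c (chart_inv c u) ac (chart_inv_dom cu).
by rewrite chart_invK // => {}inj vX; apply: inj; rewrite vX linear0.
Qed.

Lemma atlas_chart_at p : atlas (chart_at p).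
Proof. by rewrite /chart_at; case: cid => c []. Qed.

Lemma chart_at_dom p : chart_dom (chart_at p) p.
Proof. by rewrite /chart_at; case: cid => c []. Qed.

Definition chart_mean_curvature c u :=
  \tr (invmx (frame (X c) u *m (frame (X c) u)^T) *m
       (frame (N c) u *m (frame (X c) u)^T)).

(* [mean_curvature] at q is computed in [chart_at q], which varies with q, whereas
   differentiating it requires one chart for all points near p. *)
Lemma chart_mean_curvature_transition c c' p :
  atlas c -> atlas c' -> chart_dom c p -> chart_dom c' p ->
  chart_mean_curvature c' (chart_map c' p) = chart_mean_curvature c (chart_map c p).
Proof.
move=> ac ac' cp cp'.
have := chart_gram_unit ac' (chart_map_cod cp').
have := chart_gram_unit ac (chart_map_cod cp).
rewrite /chart_mean_curvature.
have [xs _] := ximm; have [ns _ _] := nunormal.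
rewrite (frame_transition ac ac' cp cp' xs) (frame_transition ac ac' cp cp' ns).
set J := 'J _ _; set E := frame _ _; set F := frame _ _.
have -> : (J *m E) *m (J *m E)^T = J *m (E *m E^T) *m J^T.
  by rewrite trmx_mul !mulmxA.
have -> : (J *m F) *m (J *m E)^T = J *m (F *m E^T) *m J^T.
  by rewrite trmx_mul !mulmxA.
(* Invertibility of [J] is read off from that of the Gram matrix in the chart [c']. *)
move=> Gu; rewrite !unitmx_mul => /andP[/andP[Ju _] _].
exact: mxtrace_congruence.
Qed.

(** * Coordinate expressions at a point, in its chosen chart *)

Section AtPoint.
Variable p : M.
Let c := chart_at p.
Let u := chart_map c p.
Let E := frame (X c) u.
Let F := frame (N c) u.
Let g := invmx (E *m E^T).
Let b := F *m E^T.
Let S := weingarten E F.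

Lemma chart_point : chart_inv c u = p.
Proof. by rewrite chart_mapK //; exact: chart_at_dom. Qed.

Lemma tangent_derivativeE (Y : M -> 'rV[R]_m.+1) v :
  tangent_derivative x Y p v = v *m E^T *m g *m frame (Y \o chart_inv c) u.
Proof.
rewrite mulmx_sum_row; apply: eq_bigr => i _.
rewrite row_frame; congr (_ *: _).
rewrite mxE; apply: eq_bigr => j _.
have gsym : g i j = g j i.
  by have := congr1 (fun A : 'M[R]_m => A j i) (inv_gram_sym E); rewrite mxE.
by rewrite mulmx_trE row_id row_frame -/c inv_metricE -/u -/E -/g gsym mulrC.
Qed.

Lemma second_formE v w : second_form x nu p v w = dot (v *m S) w.
Proof. by rewrite /second_form tangent_derivativeE -/F /S /weingarten !mulmxA. Qed.

Lemma second_form_frame i j :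
  second_form x nu p (chart_partial c i x p) (chart_partial c j x p) = b i j.
Proof.
rewrite second_formE.
have -> : chart_partial c i x p = row i E by rewrite row_frame.
have -> : chart_partial c j x p = row j E by rewrite row_frame.
rewrite -row_mul -mulmx_trE; congr (fun_of_matrix _ i j).
rewrite /S /weingarten !mulmxA mulmxV ?mul1mx //.
apply: chart_gram_unit; first exact: atlas_chart_at.
by apply: chart_map_cod; exact: chart_at_dom.
Qed.

Lemma mean_curvatureE : mean_curvature x nu p = chart_mean_curvature c u.
Proof.
rewrite /mean_curvature /chart_mean_curvature -/E -/F -/g -/b -/c -sum_mul_inv_gram.
apply: eq_bigr => i _; apply: eq_bigr => j _.
by rewrite second_form_frame inv_metricE.
Qed.

Lemma chart_at_cod : chart_cod c u.
Proof. by apply: chart_map_cod; exact: chart_at_dom. Qed.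

Lemma chart_christoffel k i j :
  christoffel x c k i j p =
  ('D_(delta_mx 0 i) ('D_(delta_mx 0 j) (X c)) u *m E^T *m g) 0 k.
Proof.
have [Xs _] := chart_smooth (atlas_chart_at p).
rewrite -(christoffel_frame (@chart_cod_open _ _ _ c) Xs k i j chart_at_cod).
rewrite [LHS]/christoffel.
apply: (congr1 ( *%R 2^-1)); apply: eq_bigr => l _.
have d i' j' l' := chart_partial_metric x i' j' l' (chart_at_dom p).
by rewrite inv_metricE (d i j l) (d j i l) (d l i j).
Qed.

Lemma chart_laplacian (f : M -> R) :
  laplacian x f p = \sum_i \sum_j g i j *
    ('D_(delta_mx 0 i) ('D_(delta_mx 0 j) (f \o chart_inv c)) u -
     \sum_k ('D_(delta_mx 0 i) ('D_(delta_mx 0 j) (X c)) u *m E^T *m g) 0 k *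
       'D_(delta_mx 0 k) (f \o chart_inv c) u).
Proof.
apply: eq_bigr => i _; apply: eq_bigr => j _; rewrite inv_metricE /hessian.
apply: (congr2 (fun y z => g i j * (y - z))).
  exact: (chart_partial_partial i j f (chart_at_dom p)).
by apply: eq_bigr => k _; rewrite -/c chart_christoffel.
Qed.

Lemma chart_gradient (f : M -> R) :
  gradient x f p = \sum_i \sum_j (g i j * 'D_(delta_mx 0 i) (f \o chart_inv c) u) *: row j E.
Proof.
apply: eq_bigr => i _; apply: eq_bigr => j _.
by rewrite inv_metricE row_frame.
Qed.

Let XsNs := chart_smooth (atlas_chart_at p).
Let Gunit := chart_gram_unit (atlas_chart_at p) chart_at_cod.

Lemma point_normal_unit : nu p *m (nu p)^T = 1%:M.
Proof. by rewrite [LHS]mx11_scalar -dotE; have [_ -> _] := nunormal. Qed.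

Lemma point_frame_normal : E *m (nu p)^T = 0.
Proof.
by have := chart_normal (atlas_chart_at p) chart_at_cod; rewrite /N /= chart_point.
Qed.

Lemma point_normal_frame_normal : F *m (nu p)^T = 0.
Proof.
have [_ Ns] := XsNs.
have := frame_normal_normal (@chart_cod_open _ _ _ c) Ns
  (fun v _ => chart_normal_unit _ v) chart_at_cod.
by rewrite /N /= chart_point.
Qed.

Lemma point_second_form_sym : b^T = b.
Proof.
have [Xs Ns] := XsNs.
exact: (second_form_sym (@chart_cod_open _ _ _ c) Xs Ns
  (fun v cv => chart_normal (atlas_chart_at p) cv) chart_at_cod).
Qed.

Lemma second_form_sqnormE : second_form_sqnorm x nu p = \tr (S *m S^T).
Proof.
rewrite /S weingarten_sqnorm //.
rewrite (weingarten_sqnorm_coef Gunit point_normal_unit point_frame_normal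
  point_normal_frame_normal point_second_form_sym) -/b -mulmxA -sum_mul_inv_gram.
apply: eq_bigr => i _; rewrite exchange_big; apply: eq_bigr => k _.
rewrite mulmxA [in RHS]mxE mulr_sumr exchange_big; apply: eq_bigr => l _.
rewrite [in RHS]mxE mulr_suml mulr_sumr; apply: eq_bigr => j _.
have bsym : b l k = b k l.
  by have := congr1 (fun A : 'M[R]_m => A k l) point_second_form_sym; rewrite mxE.
by rewrite -/c !second_form_frame !inv_metricE bsym -/u -/E -/g; ring.
Qed.

Lemma tangent_part_normal : tangent_part x nu p *m (nu p)^T = 0.
Proof.
rewrite /tangent_part mulmxBl -scalemxAl point_normal_unit dotE.
by rewrite [X in X - _]mx11_scalar scalemx1 subrr.
Qed.

Lemma mean_curvature_trace : mean_curvature x nu p = \tr S.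
Proof. by rewrite weingarten_trace mean_curvatureE. Qed.

End AtPoint.

(** * The identity under constant weighted mean curvature *)

Variable h : R.
Hypothesis cmc : forall q, weighted_mean_curvature x nu q = h.

Lemma chart_cmc c v : atlas c -> chart_cod c v ->
  chart_mean_curvature c v + 2^-1 * dot (X c v) (N c v) = h.
Proof.
move=> ac cv; rewrite -(cmc (chart_inv c v)) /weighted_mean_curvature; congr (_ + _).
rewrite mean_curvatureE -[in LHS](chart_invK cv).
apply: (chart_mean_curvature_transition (atlas_chart_at _) ac (chart_at_dom _)).
exact: chart_inv_dom.
Qed.

Lemma stability_test_F p :
  stability_operator x nu (test_F x nu) p =
  potential_P x nu p * potential_V x p - h ^+ 2.
Proof.
rewrite /stability_operator /weighted_laplacian /potential_P.
rewrite chart_laplacian chart_gradient second_form_sqnormE.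
(* The weighted mean curvature enters [test_F] as a function on [M]; it is replaced by its constant
   value before F is differentiated. *)
have -> : test_F x nu = fun q => potential_V x q - h * dot (x q) (nu q).
  by apply/funext => q; rewrite /test_F cmc.
have [Xs Ns] := chart_smooth (atlas_chart_at p).
have := local_stability (@chart_cod_open _ _ _ _) Xs Ns
  (fun v _ => chart_normal_unit _ v)
  (fun v cv => chart_normal (atlas_chart_at p) cv)
  (fun v cv => chart_gram_unit (atlas_chart_at p) cv)
  (fun v cv => chart_cmc (atlas_chart_at p) cv) (chart_at_cod p).
rewrite /X /N /= !chart_point.
exact.
Qed.

End Hypersurface.
End Charts.

Theorem proposition3p3 (R : realType) (m : nat) (hm : (2 <= m)%N)
    (M : smoothManifold R m) (hM : compact [set: M])
    (x nu : M -> 'rV[R]_m.+1) (hx : immersion x) (hnu : unit_normal x nu)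
    (hH : exists h : R, forall p : M, weighted_mean_curvature x nu p = h)
    (p : M) :
  let V := potential_V x p in
  let P := potential_P x nu p in
  let Hphi := weighted_mean_curvature x nu p in
  let xT := tangent_part x nu p in
  [/\ V * stability_operator x nu (test_F x nu) p = V * (P * V - Hphi ^+ 2),
      V * (P * V - Hphi ^+ 2) >= Hphi * second_form x nu p xT xT
    & xT <> 0 -> V * (P * V - Hphi ^+ 2) > Hphi * second_form x nu p xT xT].
Proof.
move=> V P Hphi xT; have [h cmc] := hH.
pose S := weingarten (frame (x \o chart_inv (chart_at p)) (chart_map (chart_at p) p))
  (frame (nu \o chart_inv (chart_at p)) (chart_map (chart_at p) p)).
have nunu := point_normal_unit hnu p.
have Snu : S *m (nu p)^T = 0.
  exact: weingarten_normal (point_normal_frame_normal hx hnu p).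
have xTnu : xT *m (nu p)^T = 0 by exact: tangent_part_normal hnu p.
have PE : P = \tr (S *m S^T) + 2^-1 by rewrite /P /potential_P (second_form_sqnormE hx hnu).
have HE : Hphi = \tr S + 2^-1 * dot (x p) (nu p).
  by rewrite /Hphi /weighted_mean_curvature (mean_curvature_trace hx hnu).
have AE : second_form x nu p xT xT = dot (xT *m S) xT by exact: second_formE.
(* Pythagoras for x = xT + <x, nu> nu puts [V] in the form used by the scalar inequalities. *)
have VE : V = m%:R + (dot (x p) (nu p) ^+ 2 + dot xT xT) / 2.
  rewrite /V /potential_V; congr (_ + _ / _).
  have xE : x p = xT + dot (x p) (nu p) *: nu p by rewrite /xT /tangent_part subrK.
  rewrite [in LHS]xE dot_orthogonal_sum //; last by rewrite dotE xTnu mxE.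
  by have [_ -> _] := hnu.
have m2 : (2 : R) <= m%:R by rewrite ler_nat.
have strict : xT <> 0 -> V * (P * V - Hphi ^+ 2) > Hphi * second_form x nu p xT xT.
  move=> xT0; have t0 := dot_gt0 xT0.
  (* The normal curvature in the direction xT. *)
  pose a := dot (xT *m S) xT / dot xT xT.
  have at_ : dot (xT *m S) xT = a * dot xT xT by rewrite divfK ?gt_eqF.
  rewrite AE at_ PE; apply: (weighted_inequality_strict VE HE m2 t0).
  by apply: (shape_sqnorm_lower_bound hm nunu xTnu Snu); rewrite -!dotE // gt_eqF.
split=> //.
  by rewrite (stability_test_F hx hnu cmc) -/P -/V /Hphi cmc.
(* Where xT = 0 the second fundamental form term vanishes, and Hphi^2 <= P V remains. *)
have [xT0|/eqP xT0] := eqVneq xT 0; last exact/ltW/strict.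
rewrite AE xT0 mul0mx dotE mul0mx mxE mulr0.
have V0 : 0 < V by rewrite VE; have := dot_ge0 xT; have := sqr_ge0 (dot (x p) (nu p)); lra.
rewrite mulr_ge0 ?(ltW V0) // subr_ge0 HE PE VE xT0 (dotE 0) mul0mx mxE addr0.
apply: weighted_inequality_umbilic; first by lra.
by apply: shape_sqnorm_trace nunu Snu; exact: ltnW.
Qed.
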